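(* For every group $G$ there exists a connected poset $P$ of height $2$ such that the interval monoid $\mathcal{M}(P)$ is a gcd-monoid and $G$ is a doubly free factor of the interval group $\mathcal{G}(P)$, i.e. $\mathcal{G}(P)\cong F*G$ for some free group $F$. Furthermore, $P$ can be taken finite if and only if $G$ is finitely presented.
   Context: For a poset $P$, the interval monoid $\mathcal{M}(P)$ (resp. interval group $\mathcal{G}(P)$) is the monoid (resp. group) presented by generators $[x,y]$ for all $x\le y$ in $P$ and relations $[x,x]=1$ for $x\in P$ and $[x,z]=[x,y]\cdot[y,z]$ whenever $x\le y\le z$. The height of $P$ is the supremum of cardinalities of chains of $P$ minus one. $P$ is connected if its comparability graph is connected. $*$ denotes free product of groups. A gcd-monoid is a monoid $M$ that is conical ($xy=1\Rightarrow x=1$), left and right cancellative, and in which any two elements have a greatest lower bound for left divisibility ($a\leqslant b$ iff $b=ax$ for some $x$) and a greatest lower bound for right divisibility ($a\mathbin{\widetilde\leqslant}b$ iff $b=xa$ for some $x$). *)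

(* Defs.v *)
From Stdlib Require Import List.
Import ListNotations.

Record Group := {
  g_car : Type;
  g_mul : g_car -> g_car -> g_car;
  g_one : g_car;
  g_inv : g_car -> g_car;
  g_assoc : forall x y z, g_mul x (g_mul y z) = g_mul (g_mul x y) z;
  g_mul1 : forall x, g_mul g_one x = x;
  g_mul1r : forall x, g_mul x g_one = x;
  g_mulV : forall x, g_mul (g_inv x) x = g_one;
  g_mulVr : forall x, g_mul x (g_inv x) = g_one
}.

Record Magma := {
  m_car : Type;
  m_eq : m_car -> m_car -> Prop;
  m_mul : m_car -> m_car -> m_car
}.

Definition Iso (M N : Magma) : Prop :=
  exists (f : m_car M -> m_car N) (g : m_car N -> m_car M),
    (forall a b, m_eq M a b -> m_eq N (f a) (f b)) /\
    (forall a b, m_eq N a b -> m_eq M (g a) (g b)) /\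
    (forall a b, m_eq N (f (m_mul M a b)) (m_mul N (f a) (f b))) /\
    (forall a, m_eq M (g (f a)) a) /\
    (forall b, m_eq N (f (g b)) b).

Definition magma_of_group (G : Group) : Magma :=
  {| m_car := g_car G; m_eq := @eq (g_car G); m_mul := g_mul G |}.

Inductive mcong {A : Type} (R : list A -> list A -> Prop) :
  list A -> list A -> Prop :=
| mc_refl u : mcong R u u
| mc_sym u v : mcong R u v -> mcong R v u
| mc_trans u v w : mcong R u v -> mcong R v w -> mcong R u w
| mc_rel p s u v : R u v -> mcong R (p ++ u ++ s) (p ++ v ++ s).

(* Group presented by generators A and relations R: words in A and formal
   inverses ((a,true) = a, (a,false) = a^-1) modulo the congruence generated
   by R and free cancellation. *)
Inductive gcong {A : Type} (R : list (A * bool) -> list (A * bool) -> Prop) :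
  list (A * bool) -> list (A * bool) -> Prop :=
| gc_refl u : gcong R u u
| gc_sym u v : gcong R u v -> gcong R v u
| gc_trans u v w : gcong R u v -> gcong R v w -> gcong R u w
| gc_rel p s u v : R u v -> gcong R (p ++ u ++ s) (p ++ v ++ s)
| gc_free p s a b : gcong R (p ++ (a, b) :: (a, negb b) :: s) (p ++ s).

Definition pres_group {A : Type} (R : list (A * bool) -> list (A * bool) -> Prop)
  : Magma :=
  {| m_car := list (A * bool); m_eq := gcong R; m_mul := @app (A * bool) |}.

Definition pos {A : Type} (u : list A) : list (A * bool) :=
  map (fun a => (a, true)) u.

Definition is_poset {T : Type} (le : T -> T -> Prop) : Prop :=
  (forall x, le x x) /\
  (forall x y, le x y -> le y x -> x = y) /\
  (forall x y z, le x y -> le y z -> le x z).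

Definition connected {T : Type} (le : T -> T -> Prop) : Prop :=
  forall x y : T, Relation_Operators.clos_refl_trans T
                    (fun a b => le a b \/ le b a) x y.

Definition is_chain {T : Type} (le : T -> T -> Prop) (l : list T) : Prop :=
  NoDup l /\ forall x y, In x l -> In y l -> le x y \/ le y x.

(* height = sup of (cardinality of chains) - 1 equals 2.  (Every chain with
   more than 3 elements contains a finite chain with 4 elements, so finite
   chains suffice.) *)
Definition height_eq2 {T : Type} (le : T -> T -> Prop) : Prop :=
  (exists l, is_chain le l /\ length l = 3) /\
  (forall l, is_chain le l -> length l <= 3).

Definition finite_type (T : Type) : Prop :=
  exists l : list T, forall x, In x l.

Definition interval {T : Type} (le : T -> T -> Prop) : Type :=
  { xy : T * T | le (fst xy) (snd xy) }.

Definition ivl {T : Type} {le : T -> T -> Prop} (x y : T) (h : le x y)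
  : interval le := exist (fun xy => le (fst xy) (snd xy)) (x, y) h.

Definition ivl_rel {T : Type} (le : T -> T -> Prop) :
  list (interval le) -> list (interval le) -> Prop :=
  fun u v =>
    (exists x (h : le x x), u = [ivl x x h] /\ v = []) \/
    (exists x y z (hxy : le x y) (hyz : le y z) (hxz : le x z),
        u = [ivl x z hxz] /\ v = [ivl x y hxy; ivl y z hyz]).

Definition interval_monoid_eq {T : Type} (le : T -> T -> Prop) :=
  mcong (ivl_rel le).

Definition interval_group {T : Type} (le : T -> T -> Prop) : Magma :=
  pres_group (fun u v => exists u0 v0, ivl_rel le u0 v0 /\ u = pos u0 /\ v = pos v0).

Definition is_gcd_monoid {A : Type} (eqm : list A -> list A -> Prop) : Prop :=
  let ldiv a b := exists x, eqm b (a ++ x) in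
  let rdiv a b := exists x, eqm b (x ++ a) in
  (forall x y, eqm (x ++ y) [] -> eqm x []) /\
  (forall z x y, eqm (z ++ x) (z ++ y) -> eqm x y) /\
  (forall z x y, eqm (x ++ z) (y ++ z) -> eqm x y) /\
  (forall a b, exists d, ldiv d a /\ ldiv d b /\
     forall c, ldiv c a -> ldiv c b -> ldiv c d) /\
  (forall a b, exists d, rdiv d a /\ rdiv d b /\
     forall c, rdiv c a -> rdiv c b -> rdiv c d).

Definition free_prod_rel (X : Type) (G : Group) :
  list ((X + g_car G) * bool) -> list ((X + g_car G) * bool) -> Prop :=
  fun u v =>
    (exists g h, u = [(inr g, true); (inr h, true)] /\ v = [(inr (g_mul G g h), true)]) \/
    (u = [(inr (g_one G), true)] /\ v = []).

Definition free_prod (X : Type) (G : Group) : Magma :=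
  pres_group (free_prod_rel X G).

Definition finitely_presented (G : Group) : Prop :=
  exists (A : Type), finite_type A /\
  exists rels : list (list (A * bool)),
    Iso (magma_of_group G) (pres_group (fun u v => In u rels /\ v = [])).

Definition good_poset_for (G : Group) (T : Type) (le : T -> T -> Prop) : Prop :=
  is_poset le /\ connected le /\ height_eq2 le /\
  is_gcd_monoid (interval_monoid_eq le) /\
  exists X : Type, Iso (interval_group le) (free_prod X G).

(* Main.v *)
(** For a set [S] of generators of [G] containing [1], take the triangles
    with corners 0, 1, 2 whose sides 01, 12, 02 are labelled by elements [s],
    [t], [u] of [S] with [s t = u] in [G], and glue them along corners and
    equally labelled sides. The face poset [P] of this complex has height 2; since
    two of the labels determine the third, two distinct triangles share at most
    one side, so that all principal up-sets have meets and all principal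
    down-sets have joins, and then normal forms make the interval monoid a
    gcd-monoid. The sides labelled [1] identify the three families of loops
    with one another, and the triangles become the relations [s t = u]. If
    these present [G], then the interval group is [G * F] with [F] free on the
    nonbase cells, one generator for each choice of path to the base point.
    Taking [S = G] gives the general case; a finite presentation allows a
    finite [S], namely the values of the letters and of the prefixes of the
    relators. Conversely, the interval group of a finite poset is finitely
    presented, and finite presentability passes to the retract [G]. *)

Require Import Defs.
From Stdlib Require Import List Lia Classical ClassicalEpsilon
  FunctionalExtensionality PropExtensionality ProofIrrelevance.
Import ListNotations.

Set Implicit Arguments.

(** * Groups given by presentations *)

Declare Scope grp_scope.
Local Open Scope grp_scope.
Local Notation "x * y" := (g_mul _ x y) : grp_scope.
Local Notation "1" := (g_one _) : grp_scope.
Local Notation "x ^-1" := (g_inv _ x) (at level 3, left associativity,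
  format "x ^-1") : grp_scope.

(** * Elementary identities in groups *)

Section GroupLaws.
Context {G : Group}.
Implicit Types x y z : g_car G.

Lemma mulA' x y z : (x * y) * z = x * (y * z).
Proof. symmetry; apply g_assoc. Qed.

Lemma mulKV x y : x * (x^-1 * y) = y.
Proof. now rewrite g_assoc, g_mulVr, g_mul1. Qed.

Lemma mulVK x y : x^-1 * (x * y) = y.
Proof. now rewrite g_assoc, g_mulV, g_mul1. Qed.

Lemma mulI x y z : x * y = x * z -> y = z.
Proof. intros e. rewrite <- (mulVK x y), e. apply mulVK. Qed.

Lemma inv_unique x y : x * y = 1 -> y = x^-1.
Proof. intros e. apply (@mulI x). now rewrite g_mulVr. Qed.

Lemma invK x : (x^-1)^-1 = x.
Proof. symmetry. apply inv_unique, g_mulV. Qed.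

Lemma invM x y : (x * y)^-1 = y^-1 * x^-1.
Proof. symmetry. apply inv_unique. now rewrite mulA', mulKV, g_mulVr. Qed.

Lemma inv1 : (1 : g_car G)^-1 = 1.
Proof. symmetry. apply inv_unique, g_mul1. Qed.

Lemma idempotent1 x : x * x = x -> x = 1.
Proof. intros e. apply (@mulI x). now rewrite g_mul1r. Qed.

End GroupLaws.

Ltac grp := repeat first
  [ rewrite mulA' | rewrite mulKV | rewrite mulVK | rewrite g_mul1
  | rewrite g_mul1r | rewrite g_mulV | rewrite g_mulVr | rewrite invM
  | rewrite invK | rewrite inv1 ].

Definition is_hom (G H : Group) (f : g_car G -> g_car H) : Prop :=
  forall x y, f (x * y) = f x * f y.

Lemma hom1 (G H : Group) (f : g_car G -> g_car H) : is_hom G H f -> f 1 = 1.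
Proof. intros hf. apply idempotent1. now rewrite <- hf, g_mul1. Qed.

Lemma homV (G H : Group) (f : g_car G -> g_car H) x :
  is_hom G H f -> f x^-1 = (f x)^-1.
Proof.
intros hf. apply inv_unique. now rewrite <- hf, g_mulVr, (hom1 hf).
Qed.

Definition group_iso (G H : Group) : Prop :=
  exists (f : g_car G -> g_car H) (g : g_car H -> g_car G),
    is_hom G H f /\ is_hom H G g /\
    (forall x, g (f x) = x) /\ (forall y, f (g y) = y).

(** * Evaluation of words with formal inverses in a group *)

Section Evaluation.
Context {A : Type} {H : Group}.
Implicit Types u v w : list (A * bool).

Fixpoint eval (phi : A -> g_car H) w : g_car H :=
  match w with
  | [] => 1
  | (a, b) :: w' => (if b then phi a else (phi a)^-1) * eval phi w'
  end.

Lemma eval_app phi u v : eval phi (u ++ v) = eval phi u * eval phi v.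
Proof.
induction u as [|[a b] u IH]; cbn; [now rewrite g_mul1|].
now rewrite IH, g_assoc.
Qed.

Lemma eval_gcong R phi :
  (forall u v, R u v -> eval phi u = eval phi v) ->
  forall u v, gcong R u v -> eval phi u = eval phi v.
Proof.
intros hR u v e; induction e; try congruence.
- rewrite !eval_app. now rewrite (hR _ _ H0).
- rewrite !eval_app; cbn. destruct b; cbn; now grp.
Qed.

End Evaluation.

Lemma eval_ext (A : Type) (H K : Group) (f : g_car H -> g_car K)
    (phi : A -> g_car H) (psi : A -> g_car K) w :
  is_hom H K f -> (forall a, f (phi a) = psi a) -> f (eval phi w) = eval psi w.
Proof.
intros hf e; induction w as [|[a b] w IH]; cbn; [now apply hom1|].
rewrite hf, IH. destruct b; [|rewrite (homV _ hf)]; now rewrite e.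
Qed.

(** * The group of words modulo a presentation, and its universal property *)

Section Quotient.
Context {A : Type} (R : list (A * bool) -> list (A * bool) -> Prop).
Implicit Types u v w : list (A * bool).

Lemma gcong_ctx p s u v : gcong R u v -> gcong R (p ++ u ++ s) (p ++ v ++ s).
Proof.
induction 1.
- apply gc_refl.
- now apply gc_sym.
- now apply gc_trans with (p ++ v ++ s).
- replace (p ++ (p0 ++ u ++ s0) ++ s) with ((p ++ p0) ++ u ++ (s0 ++ s))
    by now rewrite <- !app_assoc.
  replace (p ++ (p0 ++ v ++ s0) ++ s) with ((p ++ p0) ++ v ++ (s0 ++ s))
    by now rewrite <- !app_assoc.
  now apply gc_rel.
- replace (p ++ (p0 ++ (a, b) :: (a, negb b) :: s0) ++ s)
    with ((p ++ p0) ++ (a, b) :: (a, negb b) :: (s0 ++ s))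
    by now rewrite <- !app_assoc.
  replace (p ++ (p0 ++ s0) ++ s) with ((p ++ p0) ++ (s0 ++ s))
    by now rewrite <- !app_assoc.
  apply gc_free.
Qed.

Lemma gcong_app u u' v v' :
  gcong R u u' -> gcong R v v' -> gcong R (u ++ v) (u' ++ v').
Proof.
intros hu hv. apply gc_trans with (u' ++ v).
- exact (gcong_ctx [] v hu).
- rewrite <- (app_nil_r v), <- (app_nil_r v'). now apply (gcong_ctx u' []).
Qed.

Definition winv (w : list (A * bool)) : list (A * bool) :=
  rev (map (fun ab => (fst ab, negb (snd ab))) w).

Lemma winvK w : winv (winv w) = w.
Proof.
unfold winv. rewrite map_rev, rev_involutive, map_map.
rewrite <- (map_id w) at 2. apply map_ext. intros [a b]; cbn.
now rewrite Bool.negb_involutive.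
Qed.

Lemma app_winv w : gcong R (w ++ winv w) [].
Proof.
induction w as [|[a b] w IH]; [apply gc_refl|].
unfold winv in *; cbn. apply gc_trans with ([(a, b)] ++ [] ++ [(a, negb b)]).
- rewrite app_assoc. exact (gcong_ctx [(a, b)] [(a, negb b)] IH).
- exact (gc_free R [] [] a b).
Qed.

Lemma winv_app w : gcong R (winv w ++ w) [].
Proof. rewrite <- (winvK w) at 2. apply app_winv. Qed.

(** A class is encoded as the predicate of its members. With propositional and functional
    extensionality, congruent words then have equal classes, as the equality in [Group] demands. *)
Definition pg_car : Type :=
  { C : list (A * bool) -> Prop | exists w, C = gcong R w }.

Definition cls w : pg_car := exist _ (gcong R w) (ex_intro _ w eq_refl).

Lemma cls_surj (q : pg_car) : { w | q = cls w }.
Proof.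
apply constructive_indefinite_description.
destruct q as [C [w ->]]. now exists w.
Qed.

(** A chosen representative; every operation on classes is defined through it and shown not to
    depend on the choice. *)
Definition rep (q : pg_car) : list (A * bool) := proj1_sig (cls_surj q).

Lemma clsK q : cls (rep q) = q.
Proof. symmetry. exact (proj2_sig (cls_surj q)). Qed.

Lemma cls_eq u v : cls u = cls v <-> gcong R u v.
Proof.
split; intros e.
- apply (f_equal (@proj1_sig _ _)) in e; cbn in e.
  rewrite e. apply gc_refl.
- apply subset_eq_compat, functional_extensionality. intros w.
  apply propositional_extensionality. split; intros h.
  + eapply gc_trans; [apply gc_sym|]; eassumption.
  + eapply gc_trans; eassumption.
Qed.

Definition pg_mul (q r : pg_car) : pg_car := cls (rep q ++ rep r).

Lemma cls_app u v : cls (u ++ v) = pg_mul (cls u) (cls v).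
Proof. apply cls_eq. apply gcong_app; apply cls_eq; now rewrite clsK. Qed.

Lemma pg_mulA x y z : pg_mul x (pg_mul y z) = pg_mul (pg_mul x y) z.
Proof.
rewrite <- (clsK x), <- (clsK y), <- (clsK z), <- !cls_app.
now rewrite app_assoc.
Qed.

Lemma pg_mul1 x : pg_mul (cls []) x = x.
Proof. now rewrite <- (clsK x), <- cls_app. Qed.

Lemma pg_mul1r x : pg_mul x (cls []) = x.
Proof. now rewrite <- (clsK x), <- cls_app, app_nil_r. Qed.

Definition pg_inv (q : pg_car) : pg_car := cls (winv (rep q)).

Lemma pg_mulV x : pg_mul (pg_inv x) x = cls [].
Proof.
unfold pg_inv. rewrite <- (clsK x) at 2. rewrite <- cls_app.
apply cls_eq, winv_app.
Qed.

Lemma pg_mulVr x : pg_mul x (pg_inv x) = cls [].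
Proof.
unfold pg_inv. rewrite <- (clsK x) at 1. rewrite <- cls_app.
apply cls_eq, app_winv.
Qed.

Definition pg : Group :=
  {| g_car := pg_car; g_mul := pg_mul; g_one := cls []; g_inv := pg_inv;
     g_assoc := pg_mulA; g_mul1 := pg_mul1; g_mul1r := pg_mul1r;
     g_mulV := pg_mulV; g_mulVr := pg_mulVr |}.

Definition gen (a : A) : g_car pg := cls [(a, true)].

Lemma gen_inv a : cls [(a, false)] = (gen a)^-1.
Proof.
apply (@inv_unique pg). cbn. unfold gen. rewrite <- cls_app; cbn.
apply cls_eq. exact (gc_free R [] [] a true).
Qed.

Lemma cls_eval w : cls w = eval gen w.
Proof.
induction w as [|[a b] w IH]; [reflexivity|].
change ((a, b) :: w) with ([(a, b)] ++ w). rewrite cls_app; cbn.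
rewrite <- IH. f_equal. destruct b; [reflexivity|apply gen_inv].
Qed.

Lemma cls_rel u v : R u v -> eval gen u = eval gen v.
Proof.
intros h. rewrite <- !cls_eval. apply cls_eq.
rewrite <- (app_nil_r u), <- (app_nil_r v). now apply (gc_rel R [] []).
Qed.

Lemma pg_hom_ext (K : Group) (f g : g_car pg -> g_car K) :
  is_hom pg K f -> is_hom pg K g -> (forall a, f (gen a) = g (gen a)) ->
  forall q, f q = g q.
Proof.
intros hf hg e q. rewrite <- (clsK q), cls_eval.
rewrite (@eval_ext _ _ _ f gen (fun a => g (gen a)) _ hf e).
symmetry. now apply eval_ext.
Qed.

Section Lift.
Context {H : Group} (phi : A -> g_car H).

Definition lift (q : g_car pg) : g_car H := eval phi (rep q).

Hypothesis phiR : forall u v, R u v -> eval phi u = eval phi v.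

Lemma lift_cls w : lift (cls w) = eval phi w.
Proof. apply (eval_gcong phi phiR). apply cls_eq, clsK. Qed.

Lemma lift_hom : is_hom pg H lift.
Proof.
intros x y. rewrite <- (clsK x), <- (clsK y); cbn.
now rewrite <- cls_app, !lift_cls, eval_app.
Qed.

Lemma lift_gen a : lift (gen a) = phi a.
Proof. unfold gen. rewrite lift_cls; cbn. apply g_mul1r. Qed.

End Lift.
End Quotient.

(** * Passage between magmas with a congruence and honest groups *)

Definition realizes (M : Magma) (H : Group) : Prop :=
  exists p : m_car M -> g_car H,
    (forall a b, m_eq M a b <-> p a = p b) /\
    (forall a b, p (m_mul M a b) = p a * p b) /\
    (forall x, exists a, p a = x).

Lemma realizes_group (G : Group) : realizes (magma_of_group G) G.
Proof. exists (fun x => x). repeat split; eauto. Qed.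

Lemma realizes_pres (A : Type) (R : list (A * bool) -> list (A * bool) -> Prop) :
  realizes (pres_group R) (pg R).
Proof.
exists (cls R). repeat split.
- apply cls_eq.
- apply cls_eq.
- apply cls_app.
- intros x. exists (rep x). apply clsK.
Qed.

(** Surjections that identify exactly the equivalent elements allow maps to be carried back and
    forth along chosen preimages. All later work can thus be done with equality in groups. *)
Lemma realizes_iso (M N : Magma) (G H : Group) :
  realizes M G -> realizes N H -> Iso M N <-> group_iso G H.
Proof.
intros (p & pe & pm & ps) (q & qe & qm & qs).
destruct (choice _ ps) as [p' pK]. destruct (choice _ qs) as [q' qK].
split.
- intros (f & g & hf & hg & fm & gf & fg).
  (* [Iso] states multiplicativity for [f] only; for [g] it follows by writing both factors as
     values of [f]. *)
  assert (gm : forall a b, p (g (m_mul N a b)) = p (g a) * p (g b)).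
  { intros a b. rewrite <- pm. apply pe.
    assert (e : m_eq N (m_mul N a b) (f (m_mul M (g a) (g b)))).
    { apply qe. rewrite (proj1 (qe _ _) (fm _ _)), !qm.
      now rewrite !(proj1 (qe _ _) (fg _)). }
    apply hg in e. apply pe. apply pe in e. rewrite e. apply pe, gf. }
  exists (fun x => q (f (p' x))), (fun y => p (g (q' y))). repeat split.
  + intros x y. rewrite <- qm, <- (proj1 (qe _ _) (fm _ _)).
    apply qe, hf, pe. now rewrite pm, !pK.
  + intros x y. rewrite <- gm. apply pe, hg, qe. now rewrite qm, !qK.
  + intros x. rewrite <- (pK x) at 2. rewrite <- (proj1 (pe _ _) (gf (p' x))).
    apply pe, hg, qe. apply qK.
  + intros y. rewrite <- (qK y) at 2. rewrite <- (proj1 (qe _ _) (fg (q' y))).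
    apply qe, hf, pe. apply pK.
- intros (f & g & hf & hg & gf & fg).
  exists (fun a => q' (f (p a))), (fun b => p' (g (q b))). repeat split.
  + intros a b e. apply qe. rewrite !qK. f_equal. now apply pe.
  + intros a b e. apply pe. rewrite !pK. f_equal. now apply qe.
  + intros a b. apply qe. now rewrite qm, !qK, pm, hf.
  + intros a. apply pe. now rewrite pK, qK, gf.
  + intros b. apply qe. now rewrite qK, pK, fg.
Qed.

#[global] Arguments g_mul : simpl never.
#[global] Arguments g_inv : simpl never.
#[global] Arguments g_one : simpl never.

(** * Normal forms in interval monoids *)

(** Every principal up-set is a meet-semilattice; applied to the opposite order, every principal
    down-set is a join-semilattice. *)
Definition local_meets {T : Type} (le : T -> T -> Prop) : Prop :=
  forall a x y, le a x -> le a y ->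
  exists m, le a m /\ le m x /\ le m y /\
    forall z, le a z -> le z x -> le z y -> le z m.

Lemma mcong_ctx (A : Type) (R : list A -> list A -> Prop) p s u v :
  mcong R u v -> mcong R (p ++ u ++ s) (p ++ v ++ s).
Proof.
induction 1.
- apply mc_refl.
- now apply mc_sym.
- now apply mc_trans with (p ++ v ++ s).
- replace (p ++ (p0 ++ u ++ s0) ++ s) with ((p ++ p0) ++ u ++ (s0 ++ s))
    by now rewrite <- !app_assoc.
  replace (p ++ (p0 ++ v ++ s0) ++ s) with ((p ++ p0) ++ v ++ (s0 ++ s))
    by now rewrite <- !app_assoc.
  now apply mc_rel.
Qed.

Section Words.
Context {T : Type}.
Implicit Types (p q : T * T) (l m c d : list (T * T)).

(* Left multiplication of a normal form by one interval. *)
Definition push p l : list (T * T) :=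
  if excluded_middle_informative (fst p = snd p) then l else
  match l with
  | [] => [p]
  | q :: l' =>
      if excluded_middle_informative (snd p = fst q)
      then (fst p, snd q) :: l' else p :: l
  end.

(** Left multiplication by a whole word, last letter first; [act l []] is the normal form of [l]. *)
Fixpoint act l m : list (T * T) :=
  match l with [] => m | p :: l' => push p (act l' m) end.

Lemma act_app l m c : act (l ++ m) c = act l (act m c).
Proof. induction l as [|p l IH]; cbn; [easy|]. now rewrite IH. Qed.

Lemma push_trivial x l : push (x, x) l = l.
Proof. unfold push; cbn. now destruct excluded_middle_informative. Qed.

Lemma push_nil p : fst p <> snd p -> push p [] = [p].
Proof. unfold push. now destruct excluded_middle_informative. Qed.

Lemma push_merge x y z l : x <> y -> push (x, y) ((y, z) :: l) = (x, z) :: l.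
Proof.
intros n. unfold push; cbn.
destruct excluded_middle_informative; [easy|].
now destruct excluded_middle_informative.
Qed.

Lemma push_cons p q l :
  fst p <> snd p -> snd p <> fst q -> push p (q :: l) = p :: q :: l.
Proof.
intros n n'. unfold push; cbn.
destruct excluded_middle_informative; [easy|].
now destruct excluded_middle_informative.
Qed.

Lemma push_head p l : fst p <> snd p -> exists y m, push p l = (fst p, y) :: m.
Proof.
intros n. unfold push. destruct excluded_middle_informative; [easy|].
destruct l as [|q l]; [|destruct excluded_middle_informative].
- destruct p; cbn; eauto.
- eauto.
- destruct p; cbn; eauto.
Qed.

Lemma push_eq_nil p l : push p l = [] -> fst p = snd p /\ l = [].
Proof.
unfold push. destruct excluded_middle_informative; [easy|].
destruct l; [easy|]. now destruct excluded_middle_informative.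
Qed.

Lemma act_eq_nil l m : act l m = [] -> act l [] = [] /\ m = [].
Proof.
induction l as [|p l IH]; cbn; [easy|]. intros e.
apply push_eq_nil in e as [e e']. destruct (IH e') as [-> ->].
destruct p as [x y]; cbn in e; subst y. now rewrite push_trivial.
Qed.

Variable le : T -> T -> Prop.
Hypothesis le_poset : is_poset le.

Let le_refl : forall x, le x x := proj1 le_poset.
Let le_anti : forall x y, le x y -> le y x -> x = y := proj1 (proj2 le_poset).
Let le_trans : forall x y z, le x y -> le y z -> le x z := proj2 (proj2 le_poset).

Definition valid l : Prop := forall p, In p l -> le (fst p) (snd p).

Fixpoint normal l : Prop :=
  match l with
  | [] => True
  | p :: l' => le (fst p) (snd p) /\ fst p <> snd p /\
      match l' with [] => True | q :: _ => snd p <> fst q end /\ normal l'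
  end.

Lemma normal_valid l : normal l -> valid l.
Proof.
induction l as [|p l IH]; cbn; intros h q; [easy|].
intros [<-|i]; [easy|]. now apply IH.
Qed.

Lemma normal_push p l : le (fst p) (snd p) -> normal l -> normal (push p l).
Proof.
intros h nl. unfold push. destruct excluded_middle_informative; [easy|].
destruct l as [|q l]; [cbn; easy|].
destruct excluded_middle_informative as [e|]; [|now cbn].
destruct p as [x y], q as [y' z]; cbn in *; subst y'.
destruct nl as (h1 & h2 & h3 & h4). repeat split; eauto.
(* If the merged interval were trivial, antisymmetry would make the second of its two parts
   trivial. *)
intros <-. apply h2. now apply le_anti.
Qed.

Lemma normal_act l m : valid l -> normal m -> normal (act l m).
Proof.
induction l as [|p l IH]; cbn; intros vl nm; [easy|]. apply normal_push.
- apply vl. now left.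
- apply IH; [|easy]. intros q i. apply vl. now right.
Qed.

Lemma act_normal l : normal l -> act l [] = l.
Proof.
induction l as [|p l IH]; [easy|]. intros (h1 & h2 & h3 & h4); cbn.
rewrite (IH h4). destruct l as [|q l]; [now apply push_nil|].
now apply push_cons.
Qed.

(** The defining relation of the interval monoid holds for the action on normal words, so the monoid
    acts on them. *)
Lemma push_comp x y z l : le x y -> le y z -> normal l ->
  push (x, z) l = push (x, y) (push (y, z) l).
Proof.
intros hxy hyz nl.
destruct (classic (x = y)) as [<-|nxy]; [now rewrite push_trivial|].
destruct (classic (y = z)) as [<-|nyz]; [now rewrite push_trivial|].
assert (nxz : x <> z) by (intros <-; apply nxy; now apply le_anti).
destruct l as [|[u v] l].
- now rewrite !push_nil, push_merge.
- destruct (classic (z = u)) as [<-|nzu].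
  + now rewrite !push_merge.
  + rewrite !push_cons by easy. now rewrite push_merge.
Qed.

(** This is the source of cancellation. If [(x, y)] merged with a first letter [(y, b)] on one side
    only, equality of the first letters would force [b = y], and a normal word has no trivial
    letter. *)
Lemma push_inj p l m : normal l -> normal m -> push p l = push p m -> l = m.
Proof.
destruct p as [x y].
destruct (classic (x = y)) as [<-|n]; [now rewrite !push_trivial|].
intros nl nm.
destruct l as [|[a b] l], m as [|[a' b'] m]; [easy| | |].
- rewrite push_nil by easy. destruct (classic (y = a')) as [<-|n'].
  + rewrite push_merge by easy. intros e; injection e as e _. subst b'.
    now destruct nm as (_ & [] & _).
  + now rewrite push_cons by easy.
- rewrite push_nil by easy. destruct (classic (y = a)) as [<-|n'].
  + rewrite push_merge by easy. intros e; injection e as e _. subst b.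
    now destruct nl as (_ & [] & _).
  + now rewrite push_cons by easy.
- destruct (classic (y = a)) as [<-|n1], (classic (y = a')) as [<-|n2];
    rewrite ?push_merge, ?push_cons by easy; intros e; injection e.
  + congruence.
  + intros _ e'. now destruct nl as (_ & [] & _).
  + intros _ e'. now destruct nm as (_ & [] & _).
  + congruence.
Qed.

Lemma act_inj l m c : valid l -> normal m -> normal c -> act l m = act l c -> m = c.
Proof.
induction l as [|p l IH]; cbn; intros vl nm nc; [easy|]. intros e.
assert (vl' : valid l) by (intros q i; apply vl; now right).
apply IH; try easy. apply push_inj in e; try easy; now apply normal_act.
Qed.

(** The action of a word is unchanged when the word is normalised; [push_comp] handles the case of a
    merge. *)
Lemma push_act p l m : le (fst p) (snd p) -> normal l -> normal m ->
  act (push p l) m = push p (act l m).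
Proof.
destruct p as [x y]; cbn; intros hxy nl nm.
destruct (classic (x = y)) as [<-|n]; [now rewrite !push_trivial|].
destruct l as [|[a b] l]; [now rewrite push_nil|].
destruct (classic (y = a)) as [<-|n'].
- rewrite push_merge by easy; cbn. destruct nl as (h & _ & _ & nl).
  apply push_comp; try easy. apply normal_act; [|easy]. now apply normal_valid.
- now rewrite push_cons.
Qed.

Lemma act_act l m : valid l -> normal m -> act (act l []) m = act l m.
Proof.
induction l as [|p l IH]; cbn; intros vl nm; [easy|].
assert (vl' : valid l) by (intros q i; apply vl; now right).
rewrite push_act, IH; try easy.
- apply vl. now left.
- now apply normal_act.
Qed.

Lemma act_head p c m : normal (p :: c) ->
  exists y d, act (p :: c) m = (fst p, y) :: d.
Proof. intros (_ & h & _). now apply push_head. Qed.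

(** A normal divisor [c] with two or more letters keeps its first letter, because the product of the
    others still starts at the same point and cannot merge with it. Only a one-letter divisor can be
    absorbed, and then it is an initial part of [p]. *)
Lemma act_eq_cons c m p l : normal c -> act c m = p :: l ->
  c = [] \/
  (exists y, c = [(fst p, y)] /\ le (fst p) y /\ (normal m -> le y (snd p))) \/
  (exists c', c = p :: c' /\ act c' m = l).
Proof.
intros nc e. destruct c as [|[x y] [|r c]]; [now left| |].
- right. cbn in e. destruct nc as (h1 & h2 & _). cbn in h1, h2.
  destruct m as [|[u v] m].
  + rewrite push_nil in e by easy. injection e as <- <-. right. now exists [].
  + destruct (classic (y = u)) as [<-|n].
    * rewrite push_merge in e by easy. injection e as <- <-. left.
      exists y. repeat split; [easy|]. now intros (h & _).
    * rewrite push_cons in e by easy. injection e as <- <-. right. now exists [].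
- right; right. destruct nc as (h1 & h2 & h3 & nc).
  destruct (act_head m nc) as (z & d & e').
  change (act ((x, y) :: r :: c) m) with (push (x, y) (act (r :: c) m)) in e.
  rewrite e' in e. rewrite push_cons in e by easy.
  injection e as <- <-. now exists (r :: c).
Qed.

(** * Greatest common left divisors of normal words *)

Definition ndiv c l : Prop := exists m, normal m /\ l = act c m.

Lemma ndiv_nil l : normal l -> ndiv [] l.
Proof. now exists l. Qed.

Lemma ndiv_push x y z l : le x y -> le y z -> x <> z -> normal ((x, z) :: l) ->
  ndiv (push (x, y) []) ((x, z) :: l).
Proof.
intros hxy hyz nxz nl. exists (push (y, z) l). split.
- apply normal_push; [easy|]. apply nl.
- rewrite push_act; cbn; try easy.
  + rewrite <- push_comp; try easy; [|apply nl].
    rewrite <- (act_normal _ nl) at 1; cbn. rewrite act_normal; [easy|apply nl].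
  + apply normal_push; [easy|]. apply nl.
Qed.

Lemma ndiv_cons p c l : normal (p :: l) -> normal c -> ndiv c l ->
  ndiv (push p c) (p :: l).
Proof.
intros nl nc (m & nm & ->). exists m. split; [easy|].
rewrite push_act; try easy; [|apply nl].
rewrite <- (act_normal _ nl) at 1. cbn.
rewrite act_normal; [easy|apply nl].
Qed.

(** The first letters decide. Different starting points leave only the trivial divisor; equal first
    letters are split off and the tails treated by induction; a common start with different ends
    gives the single interval up to the local meet of the ends. *)
Lemma normal_gcd : local_meets le -> forall l m, normal l -> normal m ->
  exists d, normal d /\ ndiv d l /\ ndiv d m /\
    forall c, normal c -> ndiv c l -> ndiv c m -> ndiv c d.
Proof.
intros meets. induction l as [|[x y] l IH]; intros m nl nm.
{ exists []. split; [exact I|]. split; [now apply ndiv_nil|].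
  split; [now apply ndiv_nil|]. easy. }
destruct m as [|[x' y'] m].
{ exists []. split; [exact I|]. split; [now apply ndiv_nil|].
  split; [now apply ndiv_nil|]. easy. }
destruct (classic (x = x')) as [<-|nx].
2:{ exists []. split; [exact I|]. split; [now apply ndiv_nil|].
  split; [now apply ndiv_nil|]. intros [|p c] nc (k & nk & e) (k' & nk' & e').
  - now exists [].
  - exfalso. destruct (act_head k nc) as (z & d & h).
    destruct (act_head k' nc) as (z' & d' & h').
    rewrite h in e. rewrite h' in e'. congruence. }
destruct nl as (hxy & nxy & nl1 & nl). destruct nm as (hxy' & nxy' & nm1 & nm).
cbn in hxy, nxy, hxy', nxy'.
destruct (classic (y = y')) as [<-|ny].
- destruct (IH m nl nm) as (d & nd & dl & dm & dc).
  exists (push (x, y) d). split; [now apply normal_push|].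
  split; [now apply ndiv_cons|]. split; [now apply ndiv_cons|].
  intros c nc (k & nk & e) (k' & nk' & e').
  assert (xyd : normal (push (x, y) d)) by now apply normal_push.
  symmetry in e, e'.
  destruct (act_eq_cons _ _ nc e) as [->|[(z & -> & hz & hz')|(c1 & -> & e1)]].
  + now apply ndiv_nil.
  + specialize (hz' nk). cbn in hz, hz' |- *.
    exists (push (z, y) d). split; [now apply normal_push|].
    cbn. now apply push_comp.
  + destruct (act_eq_cons _ _ nc e') as [E|[(z & E & hz & hz')|(c2 & E & e2)]].
    * easy.
    * injection E as <- ->. exists d. easy.
    * injection E as <-. destruct (dc c1) as (k2 & nk2 & e2').
      -- apply nc.
      -- now exists k.
      -- now exists k'.
      -- exists k2. split; [easy|]. cbn. now rewrite <- e2'.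
- destruct (meets x y y' hxy hxy') as (w & hxw & hwy & hwy' & hw).
  assert (nw : normal (push (x, w) [])) by now apply normal_push.
  (* The meet [w] may be [x] itself, and then [push] yields the empty word. *)
  exists (push (x, w) []). split; [easy|].
  split; [now apply ndiv_push|]. split; [now apply ndiv_push|].
  intros c nc (k & nk & e) (k' & nk' & e'). symmetry in e, e'.
  (* A common divisor cannot begin with both full first letters, since their ends differ; so it has
     at most one letter, ending below both [y] and [y']. *)
  assert (H : c = [] \/ exists z, c = [(x, z)] /\ le x z /\ le z y /\ le z y').
  { destruct (act_eq_cons _ _ nc e) as [->|[(z & -> & hz & hz')|(c1 & -> & e1)]];
      [now left| |]; right;
    (destruct (act_eq_cons _ _ nc e') as [E|[(z' & E & hz1 & hz1')|(c2 & E & e2)]];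
      [easy| |]); cbn in *.
    - injection E as <-. exists z. auto.
    - injection E as -> <-. exists y'. auto.
    - injection E as -> ->. exists z'. auto.
    - congruence. }
  destruct H as [->|(z & -> & h1 & h2 & h3)]; [now apply ndiv_nil|].
  specialize (hw z h1 h2 h3). exists (push (z, w) []).
  split; [now apply normal_push|]. cbn. now apply push_comp.
Qed.

(** * Normal forms solve the word problem of the interval monoid *)

Definition pairs (u : list (interval le)) : list (T * T) := map (@proj1_sig _ _) u.

Lemma pairs_valid u : valid (pairs u).
Proof.
intros p i. apply in_map_iff in i as (q & <- & _). exact (proj2_sig q).
Qed.

Lemma pairs_inj u v : pairs u = pairs v -> u = v.
Proof.
revert v; induction u as [|[p h] u IH]; intros [|[q h'] v] e; try easy.
cbn in e. injection e as e e'. rewrite (IH _ e'). f_equal.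
now apply subset_eq_compat.
Qed.

Lemma pairs_lift l : valid l -> exists u, pairs u = l.
Proof.
induction l as [|p l IH]; intros vl; [now exists []|].
destruct IH as [u <-]; [intros q i; apply vl; now right|].
exists (exist _ p (vl p (or_introl eq_refl)) :: u). easy.
Qed.

Definition nf u : list (T * T) := act (pairs u) [].

Lemma nf_normal u : normal (nf u).
Proof. apply normal_act; [apply pairs_valid|exact I]. Qed.

Lemma nf_app u v : nf (u ++ v) = act (pairs u) (nf v).
Proof. unfold nf, pairs. now rewrite map_app, act_app. Qed.

(** Each case of [push] is at most one application of a defining relation, so a word equals its
    normal form in the monoid. *)
Lemma push_word i u : exists v,
  interval_monoid_eq le (i :: u) v /\ pairs v = push (proj1_sig i) (pairs u).
Proof.
destruct i as [[x y] h]; cbn in h |- *.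
destruct (classic (x = y)) as [<-|n].
- exists u. split; [|now rewrite push_trivial].
  apply (mc_rel (ivl_rel le) [] u [ivl x x h] []). left. now exists x, h.
- destruct u as [|[[y' z] h'] u].
  { exists [ivl x y h]. split; [apply mc_refl|]. now cbn; rewrite push_nil. }
  cbn in h'. destruct (classic (y = y')) as [<-|n'].
  + exists (ivl x z (le_trans h h') :: u). split.
    * apply mc_sym.
      apply (mc_rel (ivl_rel le) [] u [ivl x z (le_trans h h')]
               [ivl x y h; ivl y z h']).
      right. now exists x, y, z, h, h', (le_trans h h').
    * cbn. now rewrite push_merge.
  + exists (ivl x y h :: ivl y' z h' :: u). split; [apply mc_refl|].
    cbn. now rewrite push_cons.
Qed.

Lemma nf_word u : exists v, interval_monoid_eq le u v /\ pairs v = nf u.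
Proof.
induction u as [|i u (v & e & ev)].
- exists []. split; [apply mc_refl|easy].
- destruct (push_word i v) as (w & e' & ew). exists w. split.
  + apply mc_trans with (i :: v); [|easy].
    pose proof (mcong_ctx [i] [] e) as c. now rewrite !app_nil_r in c.
  + now rewrite ew, ev.
Qed.

(** Defining relations act identically on normal words, so equal elements have equal normal forms;
    the converse holds because each word is equal to its normal form. *)
Lemma interval_monoid_nf u v : interval_monoid_eq le u v <-> nf u = nf v.
Proof.
split.
- induction 1; try congruence.
  rewrite !nf_app. f_equal. destruct H as [(x & h & -> & ->)|H].
  + cbn. now rewrite push_trivial.
  + destruct H as (x & y & z & hxy & hyz & hxz & -> & ->). cbn.
    apply push_comp; [easy..|]. apply nf_normal.
- intros e. destruct (nf_word u) as (u' & eu & pu).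
  destruct (nf_word v) as (v' & ev & pv).
  assert (u' = v') as -> by (apply pairs_inj; congruence).
  eapply mc_trans; [exact eu|]. now apply mc_sym.
Qed.

Lemma nf_ldiv a b :
  (exists x, interval_monoid_eq le b (a ++ x)) <-> ndiv (nf a) (nf b).
Proof.
split.
- intros [x e]. apply interval_monoid_nf in e. exists (nf x).
  split; [apply nf_normal|]. rewrite e, nf_app.
  symmetry. apply act_act; [apply pairs_valid|apply nf_normal].
- intros (m & nm & e). destruct (@pairs_lift m) as [x <-].
  { now apply normal_valid. }
  exists x. apply interval_monoid_nf. rewrite e, nf_app. unfold nf at 2.
  rewrite (act_normal _ nm). apply act_act; [apply pairs_valid|easy].
Qed.

Lemma interval_monoid_conical x y :
  interval_monoid_eq le (x ++ y) [] -> interval_monoid_eq le x [].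
Proof.
rewrite !interval_monoid_nf, nf_app. intros e. now apply act_eq_nil in e.
Qed.

Lemma interval_monoid_cancel z x y :
  interval_monoid_eq le (z ++ x) (z ++ y) -> interval_monoid_eq le x y.
Proof.
rewrite !interval_monoid_nf, !nf_app.
apply act_inj; [apply pairs_valid|apply nf_normal..].
Qed.

Lemma interval_monoid_gcd : local_meets le -> forall a b,
  let ldiv a b := exists x, interval_monoid_eq le b (a ++ x) in
  exists g, ldiv g a /\ ldiv g b /\ forall h, ldiv h a -> ldiv h b -> ldiv h g.
Proof.
intros meets a b ldiv.
destruct (normal_gcd meets _ _ (nf_normal a) (nf_normal b))
  as (d & nd & da & db & dc).
destruct (@pairs_lift d) as [w e]; [now apply normal_valid|].
assert (ew : nf w = d) by (unfold nf; now rewrite e, act_normal).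
exists w. unfold ldiv. split; [|split].
- apply nf_ldiv. now rewrite ew.
- apply nf_ldiv. now rewrite ew.
- intros c ca cb. apply nf_ldiv. rewrite ew.
  apply dc; [apply nf_normal|now apply nf_ldiv..].
Qed.

End Words.

(** * Duality between left and right divisibility *)

Section Duality.
Context {T : Type}.

Definition op (le : T -> T -> Prop) : T -> T -> Prop := fun x y => le y x.

Lemma op_poset le : is_poset le -> is_poset (op le).
Proof.
intros (h1 & h2 & h3). split; [|split]; unfold op; eauto.
Qed.

Definition dual (le : T -> T -> Prop) (i : interval le) : interval (op le) :=
  exist (fun xy => op le (fst xy) (snd xy))
    (snd (proj1_sig i), fst (proj1_sig i)) (proj2_sig i).

(** Reversing words and intervals is an anti-isomorphism onto the interval monoid of the opposite
    poset. Right cancellation and right gcds thus reduce to their left versions there. *)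
Definition wdual (le : T -> T -> Prop) (u : list (interval le)) :
  list (interval (op le)) := rev (map (@dual le) u).

Lemma wdualK le u : wdual (wdual u) = u :> list (interval le).
Proof.
unfold wdual. rewrite map_rev, rev_involutive, map_map.
rewrite <- (map_id u) at 2. apply map_ext. now intros [[x y] h].
Qed.

Lemma wdual_app le (u v : list (interval le)) :
  wdual (u ++ v) = wdual v ++ wdual u.
Proof. unfold wdual. now rewrite map_app, rev_app_distr. Qed.

Lemma wdual_eq le u v :
  interval_monoid_eq le u v -> interval_monoid_eq (op le) (wdual u) (wdual v).
Proof.
induction 1.
- apply mc_refl.
- now apply mc_sym.
- eapply mc_trans; eassumption.
- rewrite !wdual_app, <- !app_assoc. apply mc_rel.
  destruct H as [(x & h & -> & ->)|H].
  + left. now exists x, h.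
  + right. destruct H as (x & y & z & hxy & hyz & hxz & -> & ->).
    now exists z, y, x, hyz, hxy, hxz.
Qed.

Lemma wdual_eqE le u v :
  interval_monoid_eq le u v <-> interval_monoid_eq (op le) (wdual u) (wdual v).
Proof.
split; [apply wdual_eq|]. intros e. apply wdual_eq in e.
rewrite !wdualK in e. exact e.
Qed.

End Duality.

Lemma interval_monoid_gcd_monoid (T : Type) (le : T -> T -> Prop) :
  is_poset le -> local_meets le -> local_meets (op le) ->
  is_gcd_monoid (interval_monoid_eq le).
Proof.
intros hp hm hj. pose proof (op_poset hp) as hp'.
split; [|split; [|split; [|split]]].
- intros x y. now apply interval_monoid_conical.
- intros z x y. now apply interval_monoid_cancel.
- intros z x y e. apply wdual_eqE. apply wdual_eqE in e.
  rewrite !wdual_app in e. now apply interval_monoid_cancel in e.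
- intros a b. now apply interval_monoid_gcd.
- assert (H : forall a b, (exists x, interval_monoid_eq le b (x ++ a)) <->
      exists x, interval_monoid_eq (op le) (wdual b) (wdual a ++ x)).
  { intros a b. split; intros [x e].
    - exists (wdual x). rewrite <- wdual_app. now apply wdual_eq.
    - pose proof (wdualK x : @wdual T le (wdual x) = x) as ex.
      exists (wdual x). apply wdual_eqE. now rewrite wdual_app, ex. }
  intros a b.
  destruct (interval_monoid_gcd hp' hj (wdual a) (wdual b)) as (d & da & db & dc).
  pose proof (wdualK d : @wdual T le (wdual d) = d) as ed. exists (wdual d).
  split; [|split].
  + apply H. now rewrite ed.
  + apply H. now rewrite ed.
  + intros c ca cb. apply H. rewrite ed. apply dc; now apply H.
Qed.

(** * The poset of labelled triangles *)

Inductive corner : Type := K0 | K1 | K2.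

Section TrianglePoset.
Context {G : Group} {S : Type} (iota : S -> g_car G).

Definition face : Type :=
  { t : S * S * S | iota (fst (fst t)) * iota (snd (fst t)) = iota (snd t) }.

(* The side opposite to corner [k]; sides 2, 0, 1 are the edges 01, 12, 02. *)
Definition side (k : corner) (t : face) : S :=
  match k with
  | K2 => fst (fst (proj1_sig t))
  | K0 => snd (fst (proj1_sig t))
  | K1 => snd (proj1_sig t)
  end.

(** After gluing there are just three vertices, and one edge for each pair of an opposite corner and
    a label. *)
Inductive cell : Type :=
| Vx (i : corner)
| Ed (k : corner) (s : S)
| Fc (t : face).

Definition cle (x y : cell) : Prop :=
  match x, y with
  | Vx i, Vx j => i = j
  | Vx i, Ed k _ => i <> k
  | Vx _, Fc _ => True
  | Ed k s, Ed k' s' => k = k' /\ s = s'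
  | Ed k s, Fc t => s = side k t
  | Fc t, Fc t' => t = t'
  | _, _ => False
  end.

Lemma cle_poset : is_poset cle.
Proof.
split; [|split].
- intros [i|k s|t]; cbn; auto.
- intros [i|k s|t] [i'|k' s'|t']; cbn; intuition congruence.
- intros [i|k s|t] [i'|k' s'|t'] [i''|k'' s''|t'']; cbn; intuition congruence.
Qed.

(** * Local meets and joins of cells *)

Hypothesis iota_inj : forall s t, iota s = iota t -> s = t.

Lemma face_eq (k k' : corner) (t t' : face) : k <> k' ->
  side k t = side k t' -> side k' t = side k' t' -> t = t'.
Proof.
destruct t as [[[a b] c] h], t' as [[[a' b'] c'] h']; cbn in h, h'.
intros n e e'. apply subset_eq_compat.
assert (H : a = a' /\ b = b' \/ a = a' /\ c = c' \/ b = b' /\ c = c').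
{ destruct k, k'; cbn in e, e'; try easy; auto. }
destruct H as [[<- <-]|[[<- <-]|[<- <-]]].
- f_equal. apply iota_inj. congruence.
- do 2 f_equal. apply iota_inj. apply (@mulI _ (iota a)). congruence.
- do 2 f_equal. apply iota_inj.
  assert (e1 : iota a = iota c * (iota b)^-1) by (rewrite <- h; now grp).
  rewrite e1, <- h'. now grp.
Qed.

(** An edge among two incomparable cells would be the common edge itself and lie below the other
    cell. So both are faces, and two shared sides would make them equal by [face_eq]. *)
Lemma edge_below_unique x y k k' s s' : ~ cle x y -> ~ cle y x ->
  cle (Ed k s) x -> cle (Ed k s) y -> cle (Ed k' s') x -> cle (Ed k' s') y ->
  k = k' /\ s = s'.
Proof.
intros nxy nyx.
destruct x as [|kx sx|t]; [easy| |].
{ intros [<- <-] h. easy. }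
destruct y as [|ky sy|t']; [easy| |].
{ intros h [<- <-]. easy. }
cbn. intros -> e -> e'.
assert (k = k') as <-; [|easy].
apply NNPP. intros n. apply nxy; cbn. now apply face_eq with k k'.
Qed.

(** For incomparable cells above a corner, the meet is their common edge through that corner if
    there is one, and the corner otherwise. *)
Lemma cle_local_meets : local_meets cle.
Proof.
destruct cle_poset as (refl & anti & trans).
intros a x y hx hy.
destruct (classic (cle x y)) as [h|nxy].
{ exists x. repeat split; auto. }
destruct (classic (cle y x)) as [h|nyx].
{ exists y. repeat split; auto. }
destruct a as [i|k s|t].
- destruct (classic (exists k s, i <> k /\ cle (Ed k s) x /\ cle (Ed k s) y))
    as [(k & s & hi & ex & ey)|none].
  + exists (Ed k s). repeat split; auto. intros [j|k' s'|t] iz zx zy.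
    * cbn in iz; subst j. exact hi.
    * now apply edge_below_unique with x y.
    * destruct x; try easy. cbn in zx; subst. easy.
  + exists (Vx i). repeat split; auto. intros [j|k' s'|t] iz zx zy.
    * cbn in iz; now subst j.
    * destruct none. now exists k', s'.
    * destruct x; try easy. cbn in zx; subst. easy.
- exists (Ed k s). repeat split; auto. intros [j|k' s'|t] iz zx zy.
  + easy.
  + cbn in *. intuition congruence.
  + destruct x; try easy. cbn in zx; subst. easy.
- exists (Fc t). destruct x; try easy. cbn in hx; subst. easy.
Qed.

Lemma third_corner (i j : corner) : i <> j ->
  exists k, i <> k /\ j <> k /\ forall k', i <> k' -> j <> k' -> k' = k.
Proof.
intros n; destruct i, j; try easy;
  [exists K2|exists K1|exists K2|exists K0|exists K1|exists K0];
  (split; [|split]; try easy; intros []; easy).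
Qed.

(** Below a face, two distinct corners join in the side through them; any other incomparable pair
    joins in the face. *)
Lemma cle_local_joins : local_meets (op cle).
Proof.
destruct cle_poset as (refl & anti & trans).
intros a x y hx hy; unfold op in *.
destruct (classic (cle x y)) as [h|nxy].
{ exists y. repeat split; auto. }
destruct (classic (cle y x)) as [h|nyx].
{ exists x. repeat split; auto. }
(* Incomparable cells under a common edge can only be corners. *)
assert (above_edge : forall k s, cle x (Ed k s) -> cle y (Ed k s) ->
  exists i j, x = Vx i /\ y = Vx j).
{ intros k s h1 h2. destruct x as [i|kx sx|t], y as [j|ky sy|t']; try easy.
  - now exists i, j.
  - now destruct h2 as [-> ->].
  - now destruct h1 as [-> ->].
  - now destruct h1 as [-> ->]. }
destruct a as [i|k s|t].
- exists (Vx i). destruct x; try easy. cbn in hx; subst. easy.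
- exists (Ed k s). repeat split; auto. intros [j|k' s'|t] iz zx zy.
  + destruct x, y; try easy. cbn in *; subst; easy.
  + cbn in *. intuition congruence.
  + easy.
- destruct (classic (exists i j, x = Vx i /\ y = Vx j)) as [(i & j & -> & ->)|none].
  + assert (nij : i <> j) by exact nxy.
    destruct (third_corner nij) as (k & ik & jk & uk).
    exists (Ed k (side k t)). repeat split; auto.
    intros [l|k' s'|t'] zt iz jz; cbn in *; subst.
    * easy.
    * rewrite (uk k'); auto.
    * easy.
  + exists (Fc t). repeat split; auto. intros [l|k' s'|t'] zt xz yz.
    * destruct x, y; try easy. cbn in *; subst; easy.
    * destruct none. now apply above_edge with k' s'.
    * cbn in zt; now subst.
Qed.

(** * Connectedness and height *)

Variable unit : S.
Hypothesis iota_unit : iota unit = 1.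

Lemma cle_connected : connected cle.
Proof.
set (adj := fun x y => cle x y \/ cle y x).
assert (step : forall x y, adj x y ->
  Relation_Operators.clos_refl_trans cell adj x y) by (intros; now constructor).
assert (sym : forall x y, Relation_Operators.clos_refl_trans cell adj x y ->
  Relation_Operators.clos_refl_trans cell adj y x).
{ induction 1.
  - apply step. unfold adj in *. tauto.
  - apply Relation_Operators.rt_refl.
  - eapply Relation_Operators.rt_trans; eassumption. }
(* The label [unit] supplies an edge that contains both corner 0 and corner [i]. *)
assert (vx : forall i, Relation_Operators.clos_refl_trans cell adj (Vx K0) (Vx i)).
{ intros i.
  apply Relation_Operators.rt_trans with
    (Ed (match i with K1 => K2 | _ => K1 end) unit);
    apply step; [left|right]; destruct i; easy. }
assert (all : forall x, Relation_Operators.clos_refl_trans cell adj (Vx K0) x).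
{ intros [i|k s|t].
  - apply vx.
  - apply Relation_Operators.rt_trans with (Vx (match k with K0 => K1 | _ => K0 end)).
    + apply vx.
    + apply step. left. now destruct k.
  - apply step. now left. }
intros x y. eapply Relation_Operators.rt_trans; [apply sym|]; apply all.
Qed.

Lemma unit_face : iota unit * iota unit = iota unit.
Proof. rewrite iota_unit. apply g_mul1. Qed.

Definition dim (x : cell) : nat :=
  match x with Vx _ => 0 | Ed _ _ => 1 | Fc _ => 2 end.

Lemma dim_inj x y : cle x y -> dim x = dim y -> x = y.
Proof. destruct x, y; cbn; intuition (try easy; congruence). Qed.

(** The triangle with all labels [unit] gives a chain of three cells, and [dim] is injective on
    chains, with three values. *)
Lemma cle_height : height_eq2 cle.
Proof.
split.
- set (t := exist _ (unit, unit, unit) unit_face : face).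
  exists [Vx K0; Ed K1 unit; Fc t]. split; [split|reflexivity].
  + repeat constructor; cbn; intuition easy.
  + intros x y [<-|[<-|[<-|[]]]] [<-|[<-|[<-|[]]]]; cbn; intuition easy.
- intros l [nd hl].
  assert (nd' : NoDup (map dim l)).
  { apply NoDup_map_NoDup_ForallPairs; [|easy]. intros x y ix iy e.
    destruct (hl x y ix iy) as [h|h]; [now apply dim_inj|].
    symmetry. now apply dim_inj. }
  rewrite <- (length_map dim). apply (NoDup_incl_length (l' := [0; 1; 2]%nat) nd').
  intros n i. apply in_map_iff in i as ([] & <- & _); cbn; auto.
Qed.

End TrianglePoset.

(** * The interval group *)

(** A name for the relation used inside [interval_group], to which it is convertible. *)
Definition ivl_grel {T : Type} (le : T -> T -> Prop) :
  list (interval le * bool) -> list (interval le * bool) -> Prop :=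
  fun u v => exists u0 v0, ivl_rel le u0 v0 /\ u = pos u0 /\ v = pos v0.

Arguments ivl_grel {T} le _ _.

(** * The free product of a free group and [G], with its universal property *)

Section FreeProduct.
Context (X : Type) (G : Group).

Definition fp : Group := pg (free_prod_rel X G).
Definition fp_free (x : X) : g_car fp := gen (free_prod_rel X G) (inl x).
Definition fp_in (g : g_car G) : g_car fp := gen (free_prod_rel X G) (inr g).

Lemma fp_in_hom : is_hom G fp fp_in.
Proof.
intros g h.
assert (r : free_prod_rel X G [(inr g, true); (inr h, true)] [(inr (g * h), true)]).
{ left. now exists g, h. }
apply cls_rel in r. cbn [eval] in r. rewrite !g_mul1r in r. now symmetry.
Qed.

Section FreeProductLift.
Context (H : Group) (phi : X -> g_car H) (psi : g_car G -> g_car H).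
Hypothesis psi_hom : is_hom G H psi.

Definition fp_map (a : X + g_car G) : g_car H :=
  match a with inl x => phi x | inr g => psi g end.

Lemma fp_map_rel u v :
  free_prod_rel X G u v -> eval fp_map u = eval fp_map v.
Proof.
intros [(g & h & -> & ->)|[-> ->]]; cbn.
- now rewrite psi_hom, !g_mul1r.
- now rewrite (hom1 psi_hom), g_mul1r.
Qed.

Definition fp_lift : g_car fp -> g_car H := lift fp_map.

Lemma fp_lift_hom : is_hom fp H fp_lift.
Proof. exact (lift_hom fp_map fp_map_rel). Qed.

Lemma fp_lift_free x : fp_lift (fp_free x) = phi x.
Proof. exact (lift_gen _ fp_map fp_map_rel (inl x)). Qed.

Lemma fp_lift_in g : fp_lift (fp_in g) = psi g.
Proof. exact (lift_gen _ fp_map fp_map_rel (inr g)). Qed.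

End FreeProductLift.
End FreeProduct.

(** * Splitting an interval group by means of a cocycle *)

Section IntervalGroup.
Context {T : Type} (le : T -> T -> Prop).
Hypothesis le_poset : is_poset le.

Definition ig : Group := pg (ivl_grel le).
(** The default value 1 on pairs that are not comparable keeps order proofs out of group
    computations. *)
Definition seg x y : g_car ig :=
  match excluded_middle_informative (le x y) with
  | left h => gen (ivl_grel le) (ivl x y h)
  | right _ => 1
  end.

Lemma segE x y (h : le x y) : gen (ivl_grel le) (ivl x y h) = seg x y.
Proof.
unfold seg. destruct excluded_middle_informative as [h'|]; [|easy].
now rewrite (proof_irrelevance _ h h').
Qed.

Lemma seg_comp x y z : le x y -> le y z -> seg x z = seg x y * seg y z.
Proof.
intros hxy hyz. assert (hxz : le x z) by now apply le_poset with y.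
assert (r : ivl_grel le (pos [ivl x z hxz]) (pos [ivl x y hxy; ivl y z hyz])).
{ eexists _, _. split; [|split; reflexivity]. right.
  now exists x, y, z, hxy, hyz, hxz. }
apply cls_rel in r. cbn [eval pos map] in r. now rewrite !g_mul1r, !segE in r.
Qed.

Lemma seg_refl x : seg x x = 1.
Proof. apply idempotent1. symmetry. apply seg_comp; apply le_poset. Qed.

Lemma ivl_map_rel (H : Group) (phi : interval le -> g_car H) :
  (forall x y z (hxy : le x y) (hyz : le y z) (hxz : le x z),
     phi (ivl x z hxz) = phi (ivl x y hxy) * phi (ivl y z hyz)) ->
  forall u v, ivl_grel le u v -> eval phi u = eval phi v.
Proof.
intros comp u v (u0 & v0 & [(x & h & -> & ->)|r] & -> & ->); cbn.
- rewrite g_mul1r. apply idempotent1. symmetry. apply comp.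
- destruct r as (x & y & z & hxy & hyz & hxz & -> & ->); cbn.
  rewrite !g_mul1r. apply comp.
Qed.

Context (G : Group) (base : T) (c : T -> T -> g_car G).
Context (w : T -> g_car ig) (l : g_car G -> g_car ig).
Hypothesis c_comp : forall x y z, le x y -> le y z -> c x z = c x y * c y z.
Hypothesis l_hom : is_hom G ig l.
Hypothesis w_base : w base = 1.
Hypothesis seg_eq : forall x y, le x y -> seg x y = (w x)^-1 * l (c x y) * w y.

Definition nonbase : Type := { x : T | x <> base }.

Definition vert (x : T) : g_car (fp nonbase G) :=
  match excluded_middle_informative (x = base) with
  | left _ => 1
  | right n => fp_free G (exist _ x n)
  end.

Lemma vert_base : vert base = 1.
Proof. unfold vert. now destruct excluded_middle_informative. Qed.

(** The cocycle [c] twisted by a free coboundary; the [vert] factors cancel in composites, so the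
    relations of the interval group are respected. *)
Definition trivialise (i : interval le) : g_car (fp nonbase G) :=
  let (x, y) := proj1_sig i in (vert x)^-1 * fp_in nonbase G (c x y) * vert y.

Lemma trivialise_rel u v :
  ivl_grel le u v -> eval trivialise u = eval trivialise v.
Proof.
apply ivl_map_rel. intros x y z hxy hyz hxz; cbn.
rewrite (c_comp hxy hyz), (@fp_in_hom nonbase G). now grp.
Qed.

Definition ig_to_fp : g_car ig -> g_car (fp nonbase G) := lift trivialise.

Lemma ig_to_fp_hom : is_hom ig (fp nonbase G) ig_to_fp.
Proof. exact (lift_hom trivialise trivialise_rel). Qed.

Lemma ig_to_fp_seg x y : le x y ->
  ig_to_fp (seg x y) = (vert x)^-1 * fp_in nonbase G (c x y) * vert y.
Proof.
intros h. rewrite <- (segE h).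
exact (lift_gen _ trivialise trivialise_rel (ivl x y h)).
Qed.

Hypothesis w_vert : forall x, ig_to_fp (w x) = vert x.
Hypothesis l_in : forall g, ig_to_fp (l g) = fp_in nonbase G g.

(** The inverse sends the free generator of [x] to [w x] and acts as [l] on [G]. The two composites
    are compared with the identity on generators: [seg_eq] settles the one, [w_vert] and [l_in] the
    other. *)
Lemma interval_group_split : group_iso ig (fp nonbase G).
Proof.
set (back := fp_lift ig (fun x : nonbase => w (proj1_sig x)) l).
assert (back_hom : is_hom (fp nonbase G) ig back) by now apply fp_lift_hom.
assert (back_vert : forall x, back (vert x) = w x).
{ intros x. unfold vert. destruct excluded_middle_informative as [->|n].
  - rewrite w_base. now apply hom1.
  - exact (fp_lift_free _ l_hom (exist _ x n)). }
exists ig_to_fp, back. split; [apply ig_to_fp_hom|]. split; [easy|]. split.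
- apply (@pg_hom_ext _ (ivl_grel le) ig (fun q => back (ig_to_fp q)) (fun q => q)).
  + intros x y. now rewrite ig_to_fp_hom, back_hom.
  + easy.
  + intros [[x y] h]. cbn in h. change (gen _ _) with (gen (ivl_grel le) (ivl x y h)).
    rewrite segE, (ig_to_fp_seg h), !back_hom, (homV _ back_hom), !back_vert.
    rewrite (seg_eq h). do 2 f_equal. now apply fp_lift_in.
- apply (@pg_hom_ext _ (free_prod_rel nonbase G) (fp nonbase G)
    (fun q => ig_to_fp (back q)) (fun q => q)).
  + intros x y. now rewrite back_hom, ig_to_fp_hom.
  + easy.
  + intros [[x n]|g].
    * change (ig_to_fp (back (fp_free G (exist _ x n))) = fp_free G (exist _ x n)).
      unfold back. rewrite fp_lift_free by easy. cbn. rewrite w_vert.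
      unfold vert. destruct excluded_middle_informative; [easy|].
      do 2 f_equal. apply proof_irrelevance.
    * change (ig_to_fp (back (fp_in nonbase G g)) = fp_in nonbase G g).
      unfold back. now rewrite fp_lift_in.
Qed.

End IntervalGroup.

(* The universal property of the presentation of [G] by the generators [S]
   and all relations [s * t = u] that hold in [G]. *)
Definition presented_by (G : Group) (S : Type) (iota : S -> g_car G) : Prop :=
  (forall (H : Group) (f g : g_car G -> g_car H), is_hom G H f -> is_hom G H g ->
     (forall s, f (iota s) = g (iota s)) -> forall x, f x = g x) /\
  (forall (H : Group) (alpha : S -> g_car H),
     (forall s t u, iota s * iota t = iota u -> alpha s * alpha t = alpha u) ->
     exists l, is_hom G H l /\ forall s, l (iota s) = alpha s).

(** * Loops in the triangle complex *)

Section TriangleGroup.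
Context {G : Group} {S : Type} (iota : S -> g_car G) (unit : S).
Hypothesis iota_unit : iota unit = 1.
Hypothesis iota_pres : presented_by G iota.

Let le : cell iota -> cell iota -> Prop := @cle G S iota.
Let V : corner -> cell iota := @Vx G S iota.
Let E : corner -> S -> cell iota := @Ed G S iota.
Let F : face iota -> cell iota := @Fc G S iota.

(** The side opposite to [k] is oriented from its smaller corner [tail k] to its larger corner
    [head k]. *)
Definition tail (k : corner) : corner := match k with K0 => K1 | _ => K0 end.
Definition head (k : corner) : corner := match k with K2 => K1 | _ => K2 end.

(* The poset is the quotient of a poset on which [G] acts freely. With every
   edge and face lifted from its least corner, [cocycle x y] is the element of
   [G] by which the chosen lifts of [x] and [y] differ. *)
Definition cocycle (x y : cell iota) : g_car G :=
  match x, y with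
  | Vx _ i, Ed _ k s =>
      match k, i with K0, K2 | K1, K2 | K2, K1 => (iota s)^-1 | _, _ => 1 end
  | Vx _ K1, Fc t => (iota (side K2 t))^-1
  | Vx _ K2, Fc t => (iota (side K1 t))^-1
  | Ed _ K0 _, Fc t => (iota (side K2 t))^-1
  | _, _ => 1
  end.

Lemma face_rel (t : face iota) :
  iota (side K2 t) * iota (side K0 t) = iota (side K1 t).
Proof. exact (proj2_sig t). Qed.

Lemma cocycle_comp x y z : le x y -> le y z -> cocycle x z = cocycle x y * cocycle y z.
Proof.
intros hxy hyz.
(* Corner, edge, face is the only strict chain of length three; every other case contains an
   equality. *)
assert (e : forall i k t, i <> k -> cocycle (Vx iota i) (Fc t) =
    cocycle (Vx iota i) (Ed iota k (side k t)) * cocycle (Ed iota k (side k t)) (Fc t)).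
{ intros i k t n. destruct i, k; try easy; unfold cocycle;
  rewrite <- ?face_rel; now grp. }
destruct x as [i|k s|t], y as [j|k' s'|t'], z as [m|k'' s''|t'']; try easy;
  cbn in hxy, hyz; repeat match goal with
  | H : _ /\ _ |- _ => destruct H end; subst; auto;
  repeat match goal with k : corner |- _ => destruct k end; cbn; now grp.
Qed.

Let sg : cell iota -> cell iota -> g_car (ig le) := seg le.

Lemma sg_comp x y z : le x y -> le y z -> sg x z = sg x y * sg y z.
Proof. apply seg_comp, cle_poset. Qed.

(** The edges 01 and 02 labelled [unit] serve as a tree joining corner 0, the base point, to the
    other corners. *)
Definition path (i : corner) : g_car (ig le) :=
  match i with
  | K0 => 1
  | K1 => sg (V K0) (E K2 unit) * (sg (V K1) (E K2 unit))^-1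
  | K2 => sg (V K0) (E K1 unit) * (sg (V K2) (E K1 unit))^-1
  end.

Definition branch (x : cell iota) : g_car (ig le) :=
  match x with
  | Vx _ i => path i
  | Ed _ k s => path (tail k) * sg (V (tail k)) (E k s)
  | Fc t => sg (V K0) (F t)
  end.

(** From the base point to the tail of the edge, along the edge to its head, and back along the
    tree. *)
Definition loop (k : corner) (s : S) : g_car (ig le) :=
  branch (E k s) * (sg (V (head k)) (E k s))^-1 * (path (head k))^-1.

Lemma sg_side i k (t : face iota) : i <> k ->
  sg (V i) (E k (side k t)) = sg (V i) (F t) * (sg (E k (side k t)) (F t))^-1.
Proof.
intros n. rewrite (@sg_comp (V i) (E k (side k t)) (F t)) by easy. now grp.
Qed.

(** Rerouting the loop through the face makes the product of loops around the face telescope in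
    [loop_face]. *)
Lemma loop_side k (t : face iota) : loop k (side k t) =
  path (tail k) * sg (V (tail k)) (F t) * (sg (V (head k)) (F t))^-1
    * (path (head k))^-1.
Proof. unfold loop; cbn [branch E]. rewrite !sg_side by (now destruct k). now grp. Qed.

Lemma loop_face (t : face iota) :
  loop K2 (side K2 t) * loop K0 (side K0 t) = loop K1 (side K1 t).
Proof. rewrite !loop_side. cbn [tail head]. now grp. Qed.

Lemma loop_mul s t u : iota s * iota t = iota u -> loop K2 s * loop K0 t = loop K1 u.
Proof. intros h. exact (loop_face (exist _ (s, t, u) h)). Qed.

(** Edges 01 and 02 are tree edges; for edge 12 the triangle with all labels [unit] gives the
    claim. *)
Lemma loop_unit k : loop k unit = 1.
Proof.
assert (h2 : loop K2 unit = 1) by (unfold loop; cbn; now grp).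
assert (h1 : loop K1 unit = 1) by (unfold loop; cbn; now grp).
destruct k; try easy.
rewrite <- h1, <- (@loop_mul unit unit unit), h2 by (now rewrite iota_unit, g_mul1).
now rewrite g_mul1.
Qed.

(** The triangles labelled [1, s, s] and [s, 1, s] identify the loops on the three kinds of edge. *)
Lemma loop_indep k s : loop k s = loop K1 s.
Proof.
destruct k; try easy.
- rewrite <- (@loop_mul unit s s) by (now rewrite iota_unit, g_mul1).
  now rewrite loop_unit, g_mul1.
- rewrite <- (@loop_mul s unit s) by (now rewrite iota_unit, g_mul1r).
  now rewrite loop_unit, g_mul1r.
Qed.

Lemma exists_side (i : corner) : exists k, i <> k.
Proof. destruct i; [exists K1|exists K0|exists K0]; easy. Qed.

Lemma triangle_group_split : exists X, group_iso (ig le) (fp X G).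
Proof.
destruct iota_pres as [ext univ].
(* Once the three families of loops agree, the faces give every relation among labels, so the loops
   extend to a homomorphism from [G]. *)
destruct (univ _ (loop K1)) as (l & l_hom & l_iota).
{ intros s t u h. rewrite <- (loop_indep K2 s), <- (loop_indep K0 t). now apply loop_mul. }
exists (nonbase (V K0)).
(* It suffices to treat corner-edge and edge-face pairs: a corner reaches a face through a side, and
   both expressions are multiplicative along chains. *)
assert (seg_eq : forall x y, le x y -> sg x y = (branch x)^-1 * l (cocycle x y) * branch y).
{ assert (eqE : forall i k s, i <> k -> sg (V i) (E k s) =
      (branch (V i))^-1 * l (cocycle (V i) (E k s)) * branch (E k s)).
  { intros i k s n. destruct (classic (i = tail k)) as [->|n'].
    - replace (cocycle (V (tail k)) (E k s)) with (1 : g_car G) by now destruct k.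
      rewrite (hom1 l_hom). cbn [branch V E]. now grp.
    - assert (i = head k) as -> by now destruct i, k.
      replace (cocycle (V (head k)) (E k s)) with ((iota s)^-1) by now destruct k.
      rewrite (homV _ l_hom), l_iota, <- (loop_indep k). unfold loop.
      cbn [branch V E]. now grp. }
  assert (eqF : forall k (t : face iota), sg (E k (side k t)) (F t) =
      (branch (E k (side k t)))^-1 * l (cocycle (E k (side k t)) (F t)) * branch (F t)).
  { intros k t. destruct k; cbn [branch cocycle E F tail];
      rewrite ?(homV _ l_hom), ?l_iota, ?(hom1 l_hom), <- ?(loop_indep K2 (side K2 t)),
      ?loop_side, !sg_side by easy; cbn [path tail head]; now grp. }
  intros [i|k s|t] [j|k' s'|t'] h; try easy.
  - cbn in h; subst j. unfold sg. rewrite seg_refl by apply cle_poset.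
    destruct i; cbn; rewrite (hom1 l_hom); now grp.
  - now apply eqE.
  - destruct (exists_side i) as [k n].
    assert (n' : le (V i) (E k (side k t'))) by exact n.
    change (Vx iota i) with (V i). change (Fc t') with (F t').
    rewrite (@sg_comp (V i) (E k (side k t')) (F t')) by easy.
    rewrite (@cocycle_comp (V i) (E k (side k t')) (F t')) by easy.
    rewrite l_hom, eqE, eqF by easy. now grp.
  - cbn in h. destruct h as [<- <-]. unfold sg. rewrite seg_refl by apply cle_poset.
    destruct k; cbn [cocycle]; rewrite (hom1 l_hom); now grp.
  - cbn in h; subst s. apply eqF.
  - cbn in h; subst t'. unfold sg. rewrite seg_refl by apply cle_poset.
    cbn [cocycle]; rewrite (hom1 l_hom); now grp. }
set (f := ig_to_fp (le := le) G (V K0) cocycle).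
assert (f_hom : is_hom _ _ f) by (apply ig_to_fp_hom; exact cocycle_comp).
assert (f_sg : forall x y, le x y -> f (sg x y) =
    (vert G (V K0) x)^-1 * fp_in _ G (cocycle x y) * vert G (V K0) y)
  by (intros x y h; apply ig_to_fp_seg; [exact cocycle_comp|exact h]).
pose proof (hom1 (@fp_in_hom (nonbase (V K0)) G)) as in1.
(* The tree edges are labelled [unit], so the cocycle is 1 along them. *)
assert (f_path : forall i, f (path i) = vert G (V K0) (V i)).
{ intros i. destruct i; cbn [path].
  - rewrite (hom1 f_hom). now rewrite vert_base.
  - rewrite f_hom, (homV _ f_hom), !f_sg by easy. cbn [cocycle V E].
    rewrite iota_unit, inv1, in1, vert_base. now grp.
  - rewrite f_hom, (homV _ f_hom), !f_sg by easy. cbn [cocycle V E].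
    rewrite iota_unit, inv1, in1, vert_base. now grp. }
assert (f_branch : forall x, f (branch x) = vert G (V K0) x).
{ intros [i|k s|t]; cbn [branch].
  - apply f_path.
  - rewrite f_hom, f_path, f_sg by now destruct k.
    replace (cocycle (V (tail k)) (E k s)) with (1 : g_car G) by now destruct k.
    rewrite in1. now grp.
  - rewrite f_sg by easy. cbn [cocycle V F]. rewrite in1, vert_base. now grp. }
apply (@interval_group_split _ le G (V K0) cocycle branch l);
  try easy.
- exact cocycle_comp.
(* Two homomorphisms on [G] are compared on the labels, where the loop along edge 02 retains only
   [iota s]. *)
- apply (ext _ (fun g => f (l g)) (fp_in (nonbase (V K0)) G)).
  + intros x y. now rewrite l_hom, f_hom.
  + apply fp_in_hom.
  + intros s. rewrite l_iota. unfold loop.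
    rewrite !f_hom, !(homV _ f_hom), f_branch, f_path, f_sg by easy.
    cbn [cocycle head V E]. rewrite (homV _ (@fp_in_hom _ G)). now grp.
Qed.

End TriangleGroup.

(** * Finite presentations *)

Lemma finite_prod (A B : Type) : finite_type A -> finite_type B -> finite_type (A * B).
Proof.
intros [l hl] [m hm]. exists (list_prod l m). intros [a b]. now apply in_prod.
Qed.

Lemma finite_sig (A : Type) (P : A -> Prop) (l : list A) :
  (forall x, P x -> In x l) -> finite_type {x | P x}.
Proof.
intros hl.
exists (flat_map (fun x => match excluded_middle_informative (P x) with
  | left h => [exist P x h] | right _ => [] end) l).
intros [x h]. apply in_flat_map. exists x. split; [now apply hl|].
destruct excluded_middle_informative as [h'|]; [|easy].
left. now apply subset_eq_compat.
Qed.

Lemma finite_image (A B : Type) (f : A -> B) :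
  (forall b, exists a, f a = b) -> finite_type A -> finite_type B.
Proof.
intros hf [l hl]. exists (map f l). intros b. destruct (hf b) as [a <-].
now apply in_map.
Qed.

Lemma finite_sum (A B : Type) : finite_type A -> finite_type B -> finite_type (A + B).
Proof.
intros [l hl] [m hm]. exists (map inl l ++ map inr m).
intros [a|b]; apply in_or_app; [left|right]; now apply in_map.
Qed.

Lemma finite_corner : finite_type corner.
Proof. exists [K0; K1; K2]. intros []; cbn; auto. Qed.

Lemma finite_cell (G : Group) (S : Type) (iota : S -> g_car G) :
  finite_type S -> finite_type (cell iota).
Proof.
intros fs.
assert (ff : finite_type (face iota)).
{ destruct (finite_prod (finite_prod fs fs) fs) as [l hl].
  apply finite_sig with l. auto. }
apply (finite_image (A := corner + (corner * S + face iota)) (fun x => match x with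
  | inl i => Vx iota i
  | inr (inl ks) => Ed iota (fst ks) (snd ks)
  | inr (inr t) => Fc t
  end)).
- intros [i|k s|t]; [now exists (inl i)|now exists (inr (inl (k, s)))|
    now exists (inr (inr t))].
- apply finite_sum; [apply finite_corner|]. apply finite_sum; [|easy].
  apply finite_prod; [apply finite_corner|easy].
Qed.

Lemma cell_poset_good (G : Group) (S : Type) (iota : S -> g_car G) (unit : S) :
  (forall s t, iota s = iota t -> s = t) -> iota unit = 1 -> presented_by G iota ->
  good_poset_for G (cell iota) (@cle G S iota).
Proof.
intros inj h1 pres. split; [|split; [|split; [|split]]].
- apply cle_poset.
- exact (@cle_connected G S iota unit).
- exact (@cle_height G S iota unit h1).
- apply interval_monoid_gcd_monoid.
  + apply cle_poset.
  + now apply cle_local_meets.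
  + now apply cle_local_joins.
- destruct (triangle_group_split _ h1 pres) as [X iso]. exists X.
  refine (proj2 (realizes_iso _ _) iso); apply realizes_pres.
Qed.

(** For the full multiplication table, a map respecting the relations is already a homomorphism. *)
Lemma presented_by_itself (G : Group) : presented_by G (fun x : g_car G => x).
Proof.
split.
- intros H f g _ _ e x. apply e.
- intros H alpha h. exists alpha. split; [|easy].
  intros x y. symmetry. now apply h.
Qed.

(** * A finite set of labels from a finite presentation *)

Section FinitePresentation.
Context (G : Group) (A : Type) (rels : list (list (A * bool))).
Context (letters : list A) (all_letters : forall a, In a letters).

Let R (u v : list (A * bool)) : Prop := In u rels /\ v = [].

Context (f : g_car G -> g_car (pg R)) (g : g_car (pg R) -> g_car G).
Hypothesis f_hom : is_hom G (pg R) f.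
Hypothesis g_hom : is_hom (pg R) G g.
Hypothesis gf : forall x, g (f x) = x.
Hypothesis fg : forall x, f (g x) = x.

Let val (w : list (A * bool)) : g_car G := g (cls R w).

Lemma val_app u v : val (u ++ v) = val u * val v.
Proof. unfold val. now rewrite cls_app, <- g_hom. Qed.

Lemma val_nil : val [] = 1.
Proof. exact (hom1 g_hom). Qed.

(** Both the empty prefix and the whole word are included, hence the successor of the length. *)
Definition prefixes (w : list (A * bool)) : list (list (A * bool)) :=
  map (fun n => firstn n w) (seq 0 (S (length w))).

(* Contains every letter, and is closed under removing the last letter, so
   that the value of each relator can be built up inside the generating set. *)
Definition short_words : list (list (A * bool)) :=
  [] :: map (fun a => [(a, true)]) letters ++ map (fun a => [(a, false)]) letters
     ++ flat_map prefixes rels.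

(** Labels are values in [G], not words, so that the map to [G] is injective. *)
Definition short_val : Type := { x : g_car G | In x (map val short_words) }.

Lemma short_val_finite : finite_type short_val.
Proof. now apply finite_sig with (map val short_words). Qed.

Lemma prefixesP w r : In w (prefixes r) <-> exists s, r = w ++ s.
Proof.
unfold prefixes. rewrite in_map_iff. split.
- intros (n & <- & _). exists (skipn n r). symmetry. apply firstn_skipn.
- intros [s ->]. exists (length w). split.
  + now rewrite firstn_app, firstn_all, PeanoNat.Nat.sub_diag, app_nil_r.
  + apply in_seq. rewrite length_app. lia.
Qed.

Lemma short_wordsP w : In w short_words <->
  w = [] \/ (exists x, w = [x]) \/ exists r s, In r rels /\ r = w ++ s.
Proof.
unfold short_words; cbn [In]. rewrite !in_app_iff, !in_map_iff, in_flat_map.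
split.
- intros [<-|[(a & <- & _)|[(a & <- & _)|(r & hr & h)]]]; eauto.
  apply prefixesP in h as [s e]. right; right. eauto.
- intros [->|[[[a b] ->]|(r & s & hr & e)]]; [now left|destruct b; eauto 6|].
  do 3 right. exists r. split; [easy|]. apply prefixesP. eauto.
Qed.

Lemma short_words_rcons p x : In (p ++ [x]) short_words -> In p short_words.
Proof.
rewrite !short_wordsP. intros [e|[[y e]|(r & s & hr & e)]].
- now destruct p.
- destruct p as [|z [|]]; cbn in e; [now left|easy|easy].
- right; right. exists r, ([x] ++ s). now rewrite app_assoc.
Qed.

Lemma short_words_letter x : In [x] short_words.
Proof. apply short_wordsP. eauto. Qed.

Definition short_elt w (i : In w short_words) : short_val :=
  exist (fun x => In x (map val short_words)) (val w) (in_map val _ _ i).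

(** A map [alpha] on labels determines the images of the letters. Along prefixes, evaluation of a
    short word agrees with [alpha] at its value; relators are short with value 1, so they are
    respected. *)
Lemma short_val_presents :
  presented_by G (fun x : short_val => proj1_sig x).
Proof.
split.
- intros H f1 f2 h1 h2 e x. rewrite <- (gf x), <- (clsK (f x)).
  change (f1 (val (rep (f x))) = f2 (val (rep (f x)))).
  induction (rep (f x)) as [|a w IH]; [now rewrite val_nil, (hom1 h1), (hom1 h2)|].
  change (a :: w) with ([a] ++ w). rewrite val_app, h1, h2, IH. f_equal.
  exact (e (short_elt (short_words_letter a))).
- intros H alpha h.
  (* [alpha] extended to all of [G] by the default 1, which avoids membership proofs. *)
  set (at_ := fun x => match excluded_middle_informative (In x (map val short_words)) with
    | left i => alpha (exist _ x i : short_val) | right _ => 1 end).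
  assert (atE : forall s, at_ (proj1_sig s) = alpha s).
  { intros [x i]; cbn. unfold at_. destruct excluded_middle_informative; [|easy].
    f_equal. now apply subset_eq_compat. }
  assert (atM : forall u v w, In u short_words -> In v short_words ->
    In w short_words -> val u * val v = val w -> at_ (val u) * at_ (val v) = at_ (val w)).
  { intros u v w iu iv iw e.
    pose proof (atE (short_elt iu)) as eu.
    pose proof (atE (short_elt iv)) as ev.
    pose proof (atE (short_elt iw)) as ew.
    cbn in eu, ev, ew. rewrite eu, ev, ew. now apply h. }
  assert (nilW : In [] short_words) by now left.
  assert (at1 : at_ (val []) = 1).
  { apply idempotent1. apply atM; try easy. now rewrite val_nil, g_mul1. }
  set (phi := fun a => at_ (val [(a, true)])).
  assert (at_letter : forall x, eval phi [x] = at_ (val [x])).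
  { intros [a []]; cbn [eval]; rewrite g_mul1r; [easy|].
    symmetry. apply inv_unique. unfold phi. rewrite <- at1.
    apply atM; try apply short_words_letter; [easy|].
    rewrite <- val_app. unfold val. f_equal. apply cls_eq.
    exact (gc_free R [] [] a true). }
  assert (at_short : forall w, In w short_words -> eval phi w = at_ (val w)).
  { induction w as [|x w IH] using rev_ind; [easy|]. intros i.
    pose proof (short_words_rcons _ _ i) as i'.
    rewrite eval_app, (IH i'), at_letter.
    apply atM; try easy; [apply short_words_letter|symmetry; apply val_app]. }
  assert (phiR : forall u v, R u v -> eval phi u = eval phi v).
  { intros u v [i ->]. rewrite at_short.
    - cbn. rewrite <- at1. f_equal. unfold val. f_equal. apply cls_eq.
      rewrite <- (app_nil_r u). exact (gc_rel R [] [] u [] (conj i eq_refl)).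
    - apply short_wordsP. right; right. exists u, []. now rewrite app_nil_r. }
  exists (fun x => lift (R := R) phi (f x)). split.
  + intros x y. now rewrite f_hom, (lift_hom phi phiR).
  + intros s. rewrite <- atE. destruct s as [x i]; cbn.
    apply in_map_iff in i as (w & <- & i).
    unfold val at 1. rewrite fg, (lift_cls _ phi phiR). now apply at_short.
Qed.

End FinitePresentation.

Lemma finitely_presented_poset (G : Group) : finitely_presented G ->
  exists (T : Type) (le : T -> T -> Prop), good_poset_for G T le /\ finite_type T.
Proof.
intros (A & [letters all] & rels & iso).
apply (realizes_iso (realizes_group G) (realizes_pres _)) in iso.
destruct iso as (f & g & f_hom & g_hom & gf & fg).
pose proof (short_val_presents _ letters all f_hom g_hom gf fg) as pres.
assert (i : In 1 (map (fun w => g (cls _ w)) (short_words rels letters))).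
{ left. exact (hom1 g_hom). }
exists (cell (fun x : short_val G rels letters g => proj1_sig x)), (@cle _ _ _). split.
- apply cell_poset_good with (exist _ 1 i); [|easy|easy].
  intros [x h] [y h'] e. now apply subset_eq_compat.
- apply finite_cell, short_val_finite.
Qed.

(* A retract is the quotient by the relations identifying each generator with
   its image under the retraction. *)
Lemma retract_finitely_presented (A : Type)
    (R : list (A * bool) -> list (A * bool) -> Prop) (G : Group)
    (r : g_car (pg R) -> g_car G) (s : g_car G -> g_car (pg R)) :
  finite_type A -> (exists L, forall u v, R u v -> In (u, v) L) ->
  is_hom (pg R) G r -> is_hom G (pg R) s -> (forall x, r (s x) = x) ->
  finitely_presented G.
Proof.
intros fA [L hL] r_hom s_hom rs. exists A. split; [easy|].
destruct fA as [letters all].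
(* [L] may list pairs outside [R]; the subset type keeps the genuine relations only. *)
destruct (@finite_sig _ (fun uv => R (fst uv) (snd uv)) L) as [L' hL'].
{ intros [u v]. apply hL. }
(* The relator that equates the letter [a] with its image under the retraction. *)
set (fix_word := fun a => (a, false) :: rep (s (r (gen R a)))).
exists (map (fun uv => fst (proj1_sig uv) ++ winv (snd (proj1_sig uv))) L'
  ++ map fix_word letters).
set (rels := _ ++ _). set (R' := fun u v => In u rels /\ v = []).
assert (relsP : forall w, In w rels <->
  (exists u v, R u v /\ w = u ++ winv v) \/ exists a, w = fix_word a).
{ intros w. unfold rels. rewrite in_app_iff, !in_map_iff. split.
  - intros [([[u v] h] & <- & _)|(a & <- & _)]; [left|right]; cbn; eauto.
  - intros [(u & v & h & ->)|[a ->]]; [left|right; eauto].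
    now exists (exist (fun uv => R (fst uv) (snd uv)) (u, v) h). }
clearbody rels.
apply (realizes_iso (realizes_group G) (realizes_pres _)).
change (group_iso G (pg R')).
assert (killed : forall w, In w rels -> cls R' w = 1 :> g_car (pg R')).
{ intros w h. rewrite <- (app_nil_r w). apply cls_eq.
  exact (gc_rel R' [] [] w [] (conj h eq_refl)). }
assert (kR : forall u v, R u v -> eval (gen R') u = eval (gen R') v).
{ intros u v h. rewrite <- !cls_eval.
  assert (e : g_mul (pg R') (cls R' u) (cls R' (winv v)) = 1).
  { transitivity (cls R' (u ++ winv v)); [symmetry; apply cls_app|].
    apply killed, relsP. left. eauto. }
  assert (e' : g_mul (pg R') (cls R' v) (cls R' (winv v)) = 1).
  { transitivity (cls R' (v ++ winv v)); [symmetry; apply cls_app|].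
    apply cls_eq, app_winv. }
  apply inv_unique in e, e'. rewrite <- (@invK (pg R') (cls R' u)), <- e, e'.
  apply (@invK (pg R')). }
set (k := lift (R := R) (gen R')).
assert (k_hom : is_hom (pg R) (pg R') k) by exact (lift_hom _ kR).
set (phi := fun a => r (gen R a)).
assert (phiR : forall u v, R' u v -> eval phi u = eval phi v).
{ intros u v [h ->].
  rewrite <- (eval_ext (gen R) phi u r_hom) by easy. rewrite <- cls_eval.
  apply relsP in h as [(u' & v' & h & ->)|[a ->]].
  - replace (cls R (u' ++ winv v')) with (1 : g_car (pg R)); [now apply hom1|].
    symmetry. apply cls_eq. apply gc_trans with (v' ++ winv v'); [|apply app_winv].
    exact (gc_rel R [] (winv v') _ _ h).
  - change (fix_word a) with ([(a, false)] ++ rep (s (phi a))).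
    rewrite cls_app, clsK, gen_inv. change (pg_mul ?x ?y) with (g_mul (pg R) x y).
    rewrite r_hom, (homV _ r_hom), rs. apply g_mulV. }
set (p := lift (R := R') phi).
assert (p_hom : is_hom (pg R') G p) by exact (lift_hom _ phiR).
(* Here [k] is the projection to the quotient and [p] is the map induced by [r]; the inverse of [p]
   is the section followed by the projection. *)
exists (fun x => k (s x)), p. repeat split.
- intros x y. now rewrite s_hom, k_hom.
- easy.
- intros x. rewrite <- (rs x) at 2.
  apply (@pg_hom_ext _ R G (fun q => p (k q)) r).
  + intros y z. now rewrite k_hom, p_hom.
  + easy.
  + intros a. unfold k, p. now rewrite (lift_gen _ _ kR), (lift_gen _ _ phiR).
- apply (@pg_hom_ext _ R' (pg R') (fun q => k (s (p q))) (fun q => q)).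
  + intros y z. now rewrite p_hom, s_hom, k_hom.
  + easy.
  + intros a. unfold p. rewrite (lift_gen _ _ phiR). unfold phi.
    assert (e : (gen R' a)^-1 * k (s (r (gen R a))) = 1).
    { rewrite <- (clsK (s (r (gen R a)))) at 1. unfold k. rewrite (lift_cls _ _ kR).
      rewrite <- cls_eval, <- gen_inv.
      transitivity (cls R' (fix_word a)); [symmetry; exact (cls_app _ [_] _)|].
      apply killed, relsP. right. eauto. }
    apply inv_unique in e. now rewrite e, invK.
Qed.

(** Killing the free factor makes [G] a retract of the interval group, whose relations are indexed
    by elements and triples of elements of the finite poset. *)
Lemma finite_poset_finitely_presented (G : Group) (T : Type) (le : T -> T -> Prop) :
  good_poset_for G T le -> finite_type T -> finitely_presented G.
Proof.
intros (hp & _ & _ & _ & X & iso) fT.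
apply (realizes_iso (realizes_pres (ivl_grel le)) (realizes_pres _)) in iso.
destruct iso as (f & g & f_hom & g_hom & gf & fg).
pose proof (finite_prod fT fT) as [l2 h2].
pose proof (finite_prod (finite_prod fT fT) fT) as [l3 h3].
set (r := fp_lift G (fun _ : X => 1) (fun x => x)).
assert (id_hom : is_hom G G (fun x => x)) by easy.
apply (@retract_finitely_presented (interval le) (ivl_grel le) G
  (fun q => r (f q)) (fun x => g (fp_in X G x))).
- apply finite_sig with l2. auto.
- set (deg := {x | le x x}).
  set (tri := {t : T * T * T | le (fst (fst t)) (snd (fst t)) /\
    le (snd (fst t)) (snd t) /\ le (fst (fst t)) (snd t)}).
  destruct fT as [l1 h1].
  destruct (@finite_sig T (fun x => le x x) l1) as [ld hd]; [auto|].
  destruct (@finite_sig (T * T * T) (fun t => le (fst (fst t)) (snd (fst t)) /\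
    le (snd (fst t)) (snd t) /\ le (fst (fst t)) (snd t)) l3) as [lt ht]; [auto|].
  exists (map (fun d : deg => (pos [ivl _ _ (proj2_sig d)], [])) ld
    ++ map (fun t : tri => (pos [ivl _ _ (proj2 (proj2 (proj2_sig t)))],
         pos [ivl _ _ (proj1 (proj2_sig t)); ivl _ _ (proj1 (proj2 (proj2_sig t)))])) lt).
  intros u v (u0 & v0 & [(x & h & -> & ->)|h] & -> & ->); apply in_app_iff.
  + left. apply in_map_iff. now exists (exist (fun x => le x x) x h).
  + right. destruct h as (x & y & z & hxy & hyz & hxz & -> & ->).
    apply in_map_iff.
    exists (exist (fun t => le (fst (fst t)) (snd (fst t)) /\
      le (snd (fst t)) (snd t) /\ le (fst (fst t)) (snd t))
      (x, y, z) (conj hxy (conj hyz hxz))).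
    split; [|apply ht].
    cbn. repeat f_equal; apply proof_irrelevance.
- intros x y. rewrite f_hom. now apply fp_lift_hom.
- intros x y. rewrite <- g_hom. f_equal. apply fp_in_hom.
- intros x. rewrite fg. now apply (fp_lift_in _ id_hom).
Qed.

Theorem theorem7p10 (G : Group) :
  (exists (T : Type) (le : T -> T -> Prop), good_poset_for G T le) /\
  ((exists (T : Type) (le : T -> T -> Prop), good_poset_for G T le /\ finite_type T)
   <-> finitely_presented G).
Proof.
split; [|split].
- exists (cell (fun x : g_car G => x)), (@cle _ _ _).
  apply cell_poset_good with 1; [easy|easy|]. apply presented_by_itself.
- intros (T & le & h & fT). now apply finite_poset_finitely_presented with T le.
- apply finitely_presented_poset.
Qed.
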